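(* Let $P$ be a finite poset and let $\mathcal{C}$ be a small abelian closed symmetric monoidal category. If $N \cong \prod_{a \in P} X_a^{\downarrow a}$ is a cofree $P$-module (with $X_a$ objects of $\mathcal{C}$) and $M$ is any $P$-module, then \[ \underline{\mathrm{Hom}}(M, N) \cong \prod_{a \in P} \mathcal{H}om_{\mathcal{C}}\big(M(a), X_a\big). \]
   Context: Let $(\mathcal{C},\otimes,\mathbf{1})$ be the monoidal category, with internal hom $\mathcal{H}om_{\mathcal{C}}(A,-)$ right adjoint to $-\otimes A$. A finite poset $P$ is viewed as a category with one morphism $a\to b$ whenever $a\le b$. A $P$-module is a functor $P\to\mathcal{C}$, and $\mathcal{C}^P$ is the category of $P$-modules and natural transformations. The enriched hom of $P$-modules is $\underline{\mathrm{Hom}}(M,N) := \int_{a\in P}\mathcal{H}om_{\mathcal{C}}(M(a),N(a))$ (an end, an object of $\mathcal{C}$). For $a\in P$ and $X\in\mathcal{C}$, the principal cofree $P$-module $X^{\downarrow a}$ is given by $X^{\downarrow a}(b)=X$ if $b\le a$ and $0$ otherwise; for $b\le c$ the map $X^{\downarrow a}(b\le c)$ is $\mathrm{id}_X$ if $c\le a$ and $0$ otherwise. A $P$-module is cofree if it is isomorphic to a product $\prod_{a\in P}X_a^{\downarrow a}$ with $X_a\in\mathcal{C}$. *)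

(* Defs.v *)
From HB Require Import structures.
From mathcomp Require Import all_boot all_order ssralg.
From mathcomp Require Import boolp.

Set Implicit Arguments.
Unset Strict Implicit.
Unset Printing Implicit Defensive.

Import Order.TTheory GRing.Theory.

Local Open Scope ring_scope.

Declare Scope cat_scope.
Delimit Scope cat_scope with cat.
Local Open Scope cat_scope.

(* Smallness: the objects of a category and its hom-sets are types, and        *)
(* morphisms are compared with Leibniz equality.                               *)

HB.mixin Record isCategory (C : Type) := {
  hom : C -> C -> Type;
  idm : forall A : C, hom A A;
  compm : forall A B D : C, hom B D -> hom A B -> hom A D;
  compm1 : forall (A B : C) (f : hom A B), compm _ _ _ f (idm A) = f;
  comp1m : forall (A B : C) (f : hom A B), compm _ _ _ (idm B) f = f;
  compmA : forall (A B D E : C) (h : hom D E) (g : hom B D) (f : hom A B),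
    compm _ _ _ h (compm _ _ _ g f) = compm _ _ _ (compm _ _ _ h g) f
}.

#[short(type="category")]
HB.structure Definition Category := {C of isCategory C}.

Arguments idm {_} A.
Arguments compm {_ A B D} g f.
Arguments compm1 {_ A B} f.
Arguments comp1m {_ A B} f.
Arguments compmA {_ A B D E} h g f.

Notation "A ~> B" := (hom A B)
  (at level 99, B at level 200, format "A  ~>  B") : cat_scope.
Notation "g \c f" := (compm g f)
  (at level 40, left associativity, format "g  \c  f") : cat_scope.

Definition inverses (C : category) (A B : C) (f : A ~> B) (g : B ~> A) : Prop :=
  g \c f = idm A /\ f \c g = idm B.

Definition is_iso (C : category) (A B : C) (f : A ~> B) : Prop :=
  exists g : B ~> A, inverses f g.

Definition isomorphic (C : category) (A B : C) : Prop :=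
  exists f : A ~> B, is_iso f.

Notation "A \iso B" := (isomorphic A B) (at level 70) : cat_scope.

Definition is_mono (C : category) (A B : C) (f : A ~> B) : Prop :=
  forall (X : C) (u v : X ~> A), f \c u = f \c v -> u = v.

Definition is_epi (C : category) (A B : C) (f : A ~> B) : Prop :=
  forall (X : C) (u v : B ~> X), u \c f = v \c f -> u = v.

Record product (C : category) (I : Type) (F : I -> C) := Product {
  prod_ob :> C;
  prod_proj : forall i : I, prod_ob ~> F i;
  prod_tuple : forall X : C, (forall i : I, X ~> F i) -> (X ~> prod_ob);
  prod_tupleK : forall (X : C) (f : forall i : I, X ~> F i) (i : I),
    prod_proj i \c prod_tuple f = f i;
  prod_tuple_uniq : forall (X : C) (u v : X ~> prod_ob),
    (forall i : I, prod_proj i \c u = prod_proj i \c v) -> u = v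
}.

Definition opcat (C : Type) : Type := C.

Notation "C ^op" := (opcat C) (at level 2, format "C ^op") : type_scope.

HB.instance Definition _ (C : category) :=
  @isCategory.Build C^op (fun A B => @hom C B A) (fun A => @idm C A)
    (fun A B D g f => @compm C D B A f g)
    (fun A B f => comp1m f) (fun A B f => compm1 f)
    (fun A B D E h g f => esym (compmA f g h)).

Section ProductCategory.
Variables C D : category.

Definition prodcat_hom (A B : C * D) : Type := ((A.1 ~> B.1) * (A.2 ~> B.2))%type.

Definition prodcat_comp (A B E : C * D)
    (g : prodcat_hom B E) (f : prodcat_hom A B) : prodcat_hom A E :=
  (g.1 \c f.1, g.2 \c f.2).

Lemma prodcat_comp1 A B (f : prodcat_hom A B) :
  prodcat_comp f (idm A.1, idm A.2) = f.
Proof. by case: f => f1 f2; rewrite /prodcat_comp /= !compm1. Qed.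

Lemma prodcat_1comp A B (f : prodcat_hom A B) :
  prodcat_comp (idm B.1, idm B.2) f = f.
Proof. by case: f => f1 f2; rewrite /prodcat_comp /= !comp1m. Qed.

Lemma prodcat_compA A B E F (h : prodcat_hom E F) (g : prodcat_hom B E)
    (f : prodcat_hom A B) :
  prodcat_comp h (prodcat_comp g f) = prodcat_comp (prodcat_comp h g) f.
Proof. by rewrite /prodcat_comp /= !compmA. Qed.

HB.instance Definition _ := @isCategory.Build (C * D)%type prodcat_hom
  (fun A => (idm A.1, idm A.2)) prodcat_comp
  prodcat_comp1 prodcat_1comp prodcat_compA.

End ProductCategory.

Definition poset_cat (d : Order.disp_t) (P : porderType d) : Type := P.

Section PosetCategory.
Variables (d : Order.disp_t) (P : porderType d).

Definition poset_hom (a b : poset_cat P) : Type := (a <= b :> P)%O.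

Definition poset_comp (a b c : poset_cat P)
  (g : poset_hom b c) (f : poset_hom a b) : poset_hom a c := le_trans f g.

HB.instance Definition _ := @isCategory.Build (poset_cat P) poset_hom
  (fun a => lexx (a : P)) poset_comp
  (fun a b f => bool_irrelevance _ _) (fun a b f => bool_irrelevance _ _)
  (fun a b c e h g f => bool_irrelevance _ _).

End PosetCategory.

Record functor (C D : category) := Functor {
  fob :> C -> D;
  fmap : forall A B : C, (A ~> B) -> (fob A ~> fob B);
  fmap1 : forall A : C, fmap (idm A) = idm (fob A);
  fmapM : forall (A B E : C) (g : B ~> E) (f : A ~> B),
    fmap (g \c f) = fmap g \c fmap f
}.

Arguments fmap {C D} F {A B} f : rename.

Definition functor_comp (C D E : category) (G : functor D E) (F : functor C D) :
  functor C E.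
Proof.
apply: (@Functor C E (fun A => G (F A)) (fun A B f => fmap G (fmap F f))).
- by move=> A; rewrite !fmap1.
- by move=> A B X g f; rewrite !fmapM.
Defined.

Definition functor_op (C D : category) (F : functor C D) : functor C^op D^op.
Proof.
apply: (@Functor C^op D^op (fun A => F A) (fun A B f => fmap F f)).
- by move=> A; apply: fmap1.
- by move=> A B X g f; apply: fmapM.
Defined.

Definition functor_prod (C D C' D' : category)
  (F : functor C D) (F' : functor C' D') : functor (C * C')%type (D * D')%type.
Proof.
apply: (@Functor (C * C')%type (D * D')%type (fun A => (F A.1, F' A.2))
  (fun A B f => (fmap F f.1, fmap F' f.2))).
- by move=> A; rewrite !fmap1.
- by move=> A B X g f; rewrite !fmapM.
Defined.

Record nattrans (C D : category) (F G : functor C D) := NatTrans {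
  ncomp :> forall A : C, F A ~> G A;
  nat_comm : forall (A B : C) (f : A ~> B),
    ncomp B \c fmap F f = fmap G f \c ncomp A
}.

Section FunctorCategory.
Variables C D : category.

Lemma nattransP (F G : functor C D) (s t : nattrans F G) :
  (forall A, s A = t A) -> s = t.
Proof.
case: s t => [s sn] [t tn] /= st.
have {}st : s = t by apply: functional_extensionality_dep.
by rewrite -st in tn *; rewrite (Prop_irrelevance sn tn).
Qed.

Definition nat_id (F : functor C D) : nattrans F F.
Proof.
by apply: (@NatTrans _ _ F F (fun A => idm (F A))) => A B f; rewrite comp1m compm1.
Defined.

Definition nat_comp (F G H : functor C D) (t : nattrans G H) (s : nattrans F G) :
  nattrans F H.
Proof.
apply: (@NatTrans _ _ F H (fun A => t A \c s A)) => A B f.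
by rewrite -compmA nat_comm compmA nat_comm compmA.
Defined.

Lemma nat_comp1 (F G : functor C D) (s : nattrans F G) : nat_comp s (nat_id F) = s.
Proof. by apply: nattransP => A; rewrite /= compm1. Qed.

Lemma nat_1comp (F G : functor C D) (s : nattrans F G) : nat_comp (nat_id G) s = s.
Proof. by apply: nattransP => A; rewrite /= comp1m. Qed.

Lemma nat_compA (F G H K : functor C D) (u : nattrans H K) (t : nattrans G H)
    (s : nattrans F G) :
  nat_comp u (nat_comp t s) = nat_comp (nat_comp u t) s.
Proof. by apply: nattransP => A; rewrite /= compmA. Qed.

HB.instance Definition _ := @isCategory.Build (functor C D) (@nattrans C D)
  nat_id nat_comp nat_comp1 nat_1comp nat_compA.

Definition pointwise_product_ob (I : Type) (F : I -> functor C D)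
  (p : forall A : C, product (fun i => F i A)) : functor C D.
Proof.
apply: (@Functor C D (fun A => p A)
  (fun A B f => prod_tuple (p B) (fun i => fmap (F i) f \c prod_proj (p A) i))).
- move=> A; apply: prod_tuple_uniq => i.
  by rewrite prod_tupleK fmap1 comp1m compm1.
- move=> A B E g f; apply: prod_tuple_uniq => i.
  by rewrite compmA !prod_tupleK -compmA prod_tupleK compmA fmapM.
Defined.

Section PointwiseProduct.
Variables (I : Type) (F : I -> functor C D).
Variable p : forall A : C, product (fun i => F i A).

Definition pointwise_proj (i : I) : pointwise_product_ob p ~> F i.
Proof.
apply: (@NatTrans C D (pointwise_product_ob p) (F i)
  (fun A => prod_proj (p A) i)) => A B f.
by rewrite /= prod_tupleK.
Defined.

Definition pointwise_tuple (X : functor C D) (t : forall i : I, nattrans X (F i)) :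
  X ~> pointwise_product_ob p.
Proof.
apply: (@NatTrans C D X (pointwise_product_ob p)
  (fun A => prod_tuple (p A) (fun i => t i A))) => A B f.
apply: prod_tuple_uniq => i.
by rewrite /= !compmA !prod_tupleK -compmA prod_tupleK nat_comm.
Defined.

Lemma pointwise_tupleK (X : functor C D) (t : forall i : I, nattrans X (F i)) (i : I) :
  pointwise_proj i \c pointwise_tuple t = t i.
Proof. by apply: nattransP => A; apply: (prod_tupleK (p A) (fun i => t i A)). Qed.

Lemma pointwise_tuple_uniq (X : functor C D)
    (u v : nattrans X (pointwise_product_ob p)) :
  (forall i : I, pointwise_proj i \c (u : X ~> _) = pointwise_proj i \c (v : X ~> _)) ->
  u = v.
Proof.
move=> uv; apply: nattransP => A; apply: prod_tuple_uniq => i.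
exact: (congr1 (fun s : nattrans _ _ => s A) (uv i)).
Qed.

Definition pointwise_product : product F :=
  @Product (functor C D) I F (pointwise_product_ob p) pointwise_proj
    pointwise_tuple pointwise_tupleK pointwise_tuple_uniq.

End PointwiseProduct.

End FunctorCategory.

Record adjunction (C D : category) (F : functor C D) (G : functor D C) :=
  Adjunction {
  adj : forall (A : C) (B : D), (F A ~> B) -> (A ~> G B);
  unadj : forall (A : C) (B : D), (A ~> G B) -> (F A ~> B);
  adjK : forall (A : C) (B : D), cancel (@adj A B) (@unadj A B);
  unadjK : forall (A : C) (B : D), cancel (@unadj A B) (@adj A B);
  adj_natl : forall (A A' : C) (B : D) (h : F A ~> B) (f : A' ~> A),
    adj (h \c fmap F f) = adj h \c f;
  adj_natr : forall (A : C) (B B' : D) (h : F A ~> B) (k : B ~> B'),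
    adj (k \c h) = fmap G k \c adj h
}.

HB.mixin Record hasHomGroups C of Category C := {
  hom_group : forall A B : C, GRing.Zmodule (A ~> B)
}.

#[short(type="homGroupCategory")]
HB.structure Definition HomGroupCategory := {C of Category C & hasHomGroups C}.

HB.instance Definition _ (C : homGroupCategory) (A B : C) := hom_group A B.

HB.mixin Record isPreadditive C of HomGroupCategory C := {
  compmDl : forall (A B D : C) (g g' : B ~> D) (f : A ~> B),
    (g + g') \c f = g \c f + g' \c f;
  compmDr : forall (A B D : C) (g : B ~> D) (f f' : A ~> B),
    g \c (f + f') = g \c f + g \c f'
}.

#[short(type="preadditiveCategory")]
HB.structure Definition Preadditive := {C of HomGroupCategory C & isPreadditive C}.

Section PreadditiveTheory.
Variable C : preadditiveCategory.

Lemma compm0 (A B D : C) (g : B ~> D) : g \c (0 : A ~> B) = 0.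
Proof. by apply: (addrI (g \c 0)); rewrite -compmDr !addr0. Qed.

Lemma comp0m (A B D : C) (f : A ~> B) : (0 : B ~> D) \c f = 0.
Proof. by apply: (addrI (0 \c f)); rewrite -compmDl !addr0. Qed.

Lemma compmBr (A B D : C) (g : B ~> D) (f f' : A ~> B) :
  g \c (f - f') = g \c f - g \c f'.
Proof. by apply/eqP; rewrite eq_sym subr_eq -compmDr subrK. Qed.

Lemma compmBl (A B D : C) (g g' : B ~> D) (f : A ~> B) :
  (g - g') \c f = g \c f - g' \c f.
Proof. by apply/eqP; rewrite eq_sym subr_eq -compmDl subrK. Qed.

Lemma compm_suml (A B D : C) (I : finType) (g : I -> (B ~> D)) (f : A ~> B) :
  (\sum_i g i) \c f = \sum_i (g i \c f).
Proof. by apply: (big_morph (fun g => g \c f)) => [g1 g2|]; rewrite ?compmDl ?comp0m. Qed.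

Lemma compm_sumr (A B D : C) (I : finType) (g : B ~> D) (f : I -> (A ~> B)) :
  g \c (\sum_i f i) = \sum_i (g \c f i).
Proof. by apply: (big_morph (fun f => g \c f)) => [f1 f2|]; rewrite ?compmDr ?compm0. Qed.

Definition is_kernel (A B K : C) (f : A ~> B) (k : K ~> A) : Prop :=
  f \c k = 0 /\
  forall (X : C) (h : X ~> A), f \c h = 0 -> exists! u : X ~> K, k \c u = h.

Definition is_cokernel (A B Q : C) (f : A ~> B) (q : B ~> Q) : Prop :=
  q \c f = 0 /\
  forall (X : C) (h : B ~> X), h \c f = 0 -> exists! u : Q ~> X, u \c q = h.

End PreadditiveTheory.

HB.mixin Record isAdditive C of Preadditive C := {
  biprod : forall I : finType, (I -> C) -> C;
  bproj : forall (I : finType) (F : I -> C) (i : I), biprod I F ~> F i;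
  binj : forall (I : finType) (F : I -> C) (i : I), F i ~> biprod I F;
  bproj_inj : forall (I : finType) (F : I -> C) (i : I),
    bproj I F i \c binj I F i = idm (F i);
  bproj_inj0 : forall (I : finType) (F : I -> C) (i j : I),
    i != j -> bproj I F i \c binj I F j = 0;
  binj_proj_sum : forall (I : finType) (F : I -> C),
    \sum_i (binj I F i \c bproj I F i) = idm (biprod I F)
}.

#[short(type="additiveCategory")]
HB.structure Definition Additive := {C of Preadditive C & isAdditive C}.

Arguments biprod {_ I} F.
Arguments bproj {_ I} F i.
Arguments binj {_ I} F i.
Arguments bproj_inj {_ I} F i.
Arguments bproj_inj0 {_ I} F i j.
Arguments binj_proj_sum {_ I} F.

HB.mixin Record isAbelian C of Additive C := {
  ker : forall A B : C, (A ~> B) -> C;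
  kerm : forall (A B : C) (f : A ~> B), ker A B f ~> A;
  kermP : forall (A B : C) (f : A ~> B), is_kernel f (kerm A B f);
  coker : forall A B : C, (A ~> B) -> C;
  cokerm : forall (A B : C) (f : A ~> B), B ~> coker A B f;
  cokermP : forall (A B : C) (f : A ~> B), is_cokernel f (cokerm A B f);
  mono_normal : forall (A B : C) (f : A ~> B), is_mono f ->
    exists (D : C) (g : B ~> D), is_kernel g f;
  epi_normal : forall (A B : C) (f : A ~> B), is_epi f ->
    exists (D : C) (g : D ~> A), is_cokernel g f
}.

#[short(type="abelianCategory")]
HB.structure Definition Abelian := {C of Additive C & isAbelian C}.

Arguments ker {_ A B} f.
Arguments kerm {_ A B} f.
Arguments kermP {_ A B} f.
Arguments coker {_ A B} f.
Arguments cokerm {_ A B} f.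
Arguments cokermP {_ A B} f.
Arguments mono_normal {_ A B} f.
Arguments epi_normal {_ A B} f.

(* The empty biproduct is a zero object, both initial and terminal. *)
Definition czero (C : additiveCategory) : C :=
  biprod (of_void C).

Lemma idm_czero (C : additiveCategory) : idm (czero C) = 0.
Proof. by rewrite -binj_proj_sum big1 => [|[]]. Qed.

Definition finprod (C : additiveCategory) (I : finType) (F : I -> C) : product F.
Proof.
apply: (@Product C I F (biprod F) (bproj F)
          (fun X f => \sum_i (binj F i \c f i))).
- move=> X f i; rewrite compm_sumr (bigD1 i) //= big1 => [|j ji].
    by rewrite addr0 compmA bproj_inj comp1m.
  by rewrite compmA bproj_inj0 1?eq_sym // comp0m.
- move=> X u v uv; rewrite -[u]comp1m -[v]comp1m -binj_proj_sum !compm_suml.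
  by apply: eq_bigr => i _; rewrite -!compmA uv.
Defined.

HB.mixin Record isMonoidal C of Category C := {
  tens : C -> C -> C;
  munit : C;
  tensm : forall A A' B B' : C, (A ~> A') -> (B ~> B') -> (tens A B ~> tens A' B');
  tensm1 : forall A B : C, tensm A A B B (idm A) (idm B) = idm (tens A B);
  tensmM : forall (A A' A'' B B' B'' : C) (f' : A' ~> A'') (f : A ~> A')
      (g' : B' ~> B'') (g : B ~> B'),
    tensm A A'' B B'' (f' \c f) (g' \c g)
    = tensm A' A'' B' B'' f' g' \c tensm A A' B B' f g;
  assoc : forall A B D : C, tens (tens A B) D ~> tens A (tens B D);
  assoc_iso : forall A B D : C, is_iso (assoc A B D);
  assoc_nat : forall (A A' B B' D D' : C)
      (f : A ~> A') (g : B ~> B') (h : D ~> D'),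
    assoc A' B' D' \c tensm _ _ _ _ (tensm _ _ _ _ f g) h
    = tensm _ _ _ _ f (tensm _ _ _ _ g h) \c assoc A B D;
  lunit : forall A : C, tens munit A ~> A;
  lunit_iso : forall A : C, is_iso (lunit A);
  lunit_nat : forall (A A' : C) (f : A ~> A'),
    lunit A' \c tensm _ _ _ _ (idm munit) f = f \c lunit A;
  runit : forall A : C, tens A munit ~> A;
  runit_iso : forall A : C, is_iso (runit A);
  runit_nat : forall (A A' : C) (f : A ~> A'),
    runit A' \c tensm _ _ _ _ f (idm munit) = f \c runit A;
  monoidal_triangle : forall A B : C,
    tensm _ _ _ _ (idm A) (lunit B) \c assoc A munit B
    = tensm _ _ _ _ (runit A) (idm B);
  monoidal_pentagon : forall A B D E : C,
    assoc A B (tens D E) \c assoc (tens A B) D E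
    = tensm _ _ _ _ (idm A) (assoc B D E)
      \c assoc A (tens B D) E \c tensm _ _ _ _ (assoc A B D) (idm E)
}.

#[short(type="monoidalCategory")]
HB.structure Definition Monoidal := {C of Category C & isMonoidal C}.

Arguments tensm {_ A A' B B'} _ _.

Notation "A \ot B" := (tens A B) (at level 40, left associativity) : cat_scope.
Notation "f \otm g" := (tensm f g) (at level 40, left associativity) : cat_scope.

Section MonoidalTheory.
Variable C : monoidalCategory.

Lemma tensmMl (A A' A'' B : C) (f' : A' ~> A'') (f : A ~> A') :
  (f' \c f) \otm idm B = (f' \otm idm B) \c (f \otm idm B).
Proof. by rewrite -tensmM comp1m. Qed.

Lemma tensmMr (A B B' B'' : C) (g' : B' ~> B'') (g : B ~> B') :
  idm A \otm (g' \c g) = (idm A \otm g') \c (idm A \otm g).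
Proof. by rewrite -tensmM comp1m. Qed.

Lemma tensm_swap (A A' B B' : C) (f : A ~> A') (g : B ~> B') :
  (f \otm idm B') \c (idm A \otm g) = (idm A' \otm g) \c (f \otm idm B).
Proof. by rewrite -!tensmM !comp1m !compm1. Qed.

End MonoidalTheory.

HB.mixin Record isSymmetric C of Monoidal C := {
  braid : forall A B : C, A \ot B ~> B \ot A;
  braid_nat : forall (A A' B B' : C) (f : A ~> A') (g : B ~> B'),
    braid A' B' \c (f \otm g) = (g \otm f) \c braid A B;
  braidK : forall A B : C, braid B A \c braid A B = idm (A \ot B);
  braid_hexagon : forall A B D : C,
    assoc B D A \c braid A (B \ot D) \c assoc A B D
    = (idm B \otm braid A D) \c assoc B A D \c (braid A B \otm idm D)
}.

#[short(type="symmetricMonoidalCategory")]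
HB.structure Definition SymmetricMonoidal := {C of Monoidal C & isSymmetric C}.

Definition tens_right (C : monoidalCategory) (A : C) : functor C C.
Proof.
apply: (@Functor C C (fun X => X \ot A) (fun X Y f => f \otm idm A)).
- by move=> X; apply: tensm1.
- by move=> X Y Z g f; rewrite -tensmM comp1m.
Defined.

HB.mixin Record isClosed C of SymmetricMonoidal C := {
  ihom_right : forall A : C, functor C C;
  ihom_adj : forall A : C, adjunction (tens_right A) (ihom_right A)
}.

#[short(type="closedSymmetricMonoidalCategory")]
HB.structure Definition ClosedSymmetricMonoidal :=
  {C of SymmetricMonoidal C & isClosed C}.

#[short(type="abelianClosedSymmetricMonoidalCategory")]
HB.structure Definition AbelianClosedSymmetricMonoidal :=
  {C of Abelian C & ClosedSymmetricMonoidal C}.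

Section InternalHom.
Variable C : closedSymmetricMonoidalCategory.

Definition ihom (A B : C) : C := ihom_right A B.

Definition ihom_ev (A B : C) : ihom A B \ot A ~> B :=
  unadj (ihom_adj A) (idm (ihom A B)).

(* The contravariant action of the internal hom is forced by the adjunctions:  *)
(* precomposition with f is the transpose of                                   *)
(* ihom A B \ot A' --(1 \ot f)--> ihom A B \ot A --ev--> B.                    *)
Definition ihom_pre (A A' B : C) (f : A' ~> A) : ihom A B ~> ihom A' B :=
  @adj _ _ _ _ (ihom_adj A') (ihom A B) B (ihom_ev A B \c (idm (ihom A B) \otm f)).

Lemma unadj_natl (A X X' B : C) (h : X ~> ihom A B) (f : X' ~> X) :
  unadj (ihom_adj A) (h \c f) = unadj (ihom_adj A) h \c (f \otm idm A).
Proof.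
apply: (can_inj (@adjK _ _ _ _ (ihom_adj A) X' B)).
by rewrite unadjK (adj_natl (ihom_adj A) (unadj (ihom_adj A) h) f) unadjK.
Qed.

Lemma unadj_natr (A X B B' : C) (h : X ~> ihom A B) (k : B ~> B') :
  unadj (ihom_adj A) (fmap (ihom_right A) k \c h) = k \c unadj (ihom_adj A) h.
Proof.
apply: (can_inj (@adjK _ _ _ _ (ihom_adj A) X B')).
by rewrite unadjK (adj_natr (ihom_adj A)) unadjK.
Qed.

Lemma ihom_evE (A X B : C) (h : X ~> ihom A B) :
  unadj (ihom_adj A) h = ihom_ev A B \c (h \otm idm A).
Proof. by rewrite -[in LHS](comp1m h) unadj_natl. Qed.

Lemma ihom_preE (A A' B : C) (f : A' ~> A) :
  ihom_ev A' B \c (ihom_pre B f \otm idm A') = ihom_ev A B \c (idm _ \otm f).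
Proof. by rewrite -ihom_evE /ihom_pre adjK. Qed.

Lemma ihom_mapE (A B B' : C) (g : B ~> B') :
  ihom_ev A B' \c (fmap (ihom_right A) g \otm idm A) = g \c ihom_ev A B.
Proof. by rewrite -ihom_evE -[X in unadj _ X]compm1 unadj_natr. Qed.

Lemma ihom_ext (A X B : C) (u v : X ~> ihom A B) :
  ihom_ev A B \c (u \otm idm A) = ihom_ev A B \c (v \otm idm A) -> u = v.
Proof. by rewrite -!ihom_evE; apply: (can_inj (@unadjK _ _ _ _ (ihom_adj A) X B)). Qed.

Lemma ihom_pre1 (A B : C) : ihom_pre B (idm A) = idm (ihom A B).
Proof. by apply: ihom_ext; rewrite ihom_preE. Qed.

Lemma ihom_preM (A A' A'' B : C) (f : A' ~> A) (f' : A'' ~> A') :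
  ihom_pre B (f \c f') = ihom_pre B f' \c ihom_pre B f.
Proof.
apply: ihom_ext; rewrite ihom_preE tensmMl compmA ihom_preE -compmA.
by rewrite -tensm_swap compmA ihom_preE -compmA tensmMr.
Qed.

Lemma ihom_pre_nat (A A' B B' : C) (f : A' ~> A) (g : B ~> B') :
  ihom_pre B' f \c fmap (ihom_right A) g = fmap (ihom_right A') g \c ihom_pre B f.
Proof.
apply: ihom_ext; rewrite !tensmMl !compmA ihom_preE ihom_mapE -!compmA ihom_preE.
by rewrite -tensm_swap compmA ihom_mapE -compmA.
Qed.

Definition ihom_functor : functor (C^op * C)%type C.
Proof.
apply: (@Functor (C^op * C)%type C (fun AB => ihom AB.1 AB.2)
  (fun AB AB' f => fmap (ihom_right AB'.1) f.2 \c ihom_pre AB.2 f.1)).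
- by move=> [A B] /=; rewrite fmap1 ihom_pre1 comp1m.
- move=> [A B] [A' B'] [A'' B''] [g1 g2] [f1 f2] /=.
  rewrite fmapM ihom_preM -!compmA; congr (_ \c _).
  by rewrite !compmA ihom_pre_nat.
Defined.

End InternalHom.

Section End.
Variables (J C : category) (T : functor (J^op * J)%type C).

Definition is_wedge (W : C) (w : forall a : J, W ~> T (a, a)) : Prop :=
  forall (a b : J) (f : a ~> b),
    @fmap _ _ T (a, a) (a, b) (idm a, f) \c w a
    = @fmap _ _ T (b, b) (a, b) (f, idm b) \c w b.

Record end_of := End {
  end_ob :> C;
  end_proj : forall a : J, end_ob ~> T (a, a);
  end_wedge : is_wedge end_proj;
  end_univ : forall (X : C) (w : forall a : J, X ~> T (a, a)), is_wedge w ->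
    exists! u : X ~> end_ob, forall a : J, end_proj a \c u = w a
}.

End End.

Section FinPosetEnd.
Variables (C : abelianCategory) (d : Order.disp_t) (P : finPOrderType d).
Variable T : functor ((poset_cat P)^op * poset_cat P)%type C.

(* The end is the equalizer, i.e., the kernel of the difference, of two maps   *)
(* \prod_a T (a, a) --> \prod_(a <= b) T (a, b).                               *)

Let I : finType := {ab : P * P | (ab.1 <= ab.2)%O}.
Let src (i : I) : poset_cat P := (val i).1.
Let tgt (i : I) : poset_cat P := (val i).2.
Let le_hom (i : I) : src i ~> tgt i := valP i.
Let Q := finprod (fun a : P => T (a : poset_cat P, a : poset_cat P)).
Let R := finprod (fun i : I => T (src i, tgt i)).

Definition end_cov : Q ~> R := prod_tuple R (fun i =>
  @fmap _ _ T (src i, src i) (src i, tgt i) (idm (src i), le_hom i)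
  \c prod_proj Q (src i)).

Definition end_contra : Q ~> R := prod_tuple R (fun i =>
  @fmap _ _ T (tgt i, tgt i) (src i, tgt i) (le_hom i, idm (tgt i))
  \c prod_proj Q (tgt i)).

Lemma end_wedgeP (X : C) (u : X ~> Q) :
  is_wedge (T := T) (fun a => prod_proj Q a \c u)
  <-> (end_cov - end_contra) \c u = 0.
Proof.
rewrite compmBl; split => [wu|/subr0_eq lru a b f].
  apply/eqP; rewrite subr_eq0; apply/eqP; apply: prod_tuple_uniq => i.
  by rewrite !compmA !prod_tupleK -!compmA; apply: wu.
pose i : I := exist _ (a, b) f.
have hi : le_hom i = f by apply: bool_irrelevance.
have := congr1 (fun h => prod_proj R i \c h) lru.
by rewrite !compmA !prod_tupleK hi -!compmA.
Qed.

Lemma end_ker_wedge :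
  is_wedge (T := T) (fun a => prod_proj Q a \c kerm (end_cov - end_contra)).
Proof. by apply/end_wedgeP; case: (kermP (end_cov - end_contra)). Qed.

Lemma end_ker_univ (X : C) (w : forall a : poset_cat P, X ~> T (a, a)) :
  is_wedge w -> exists! u : X ~> ker (end_cov - end_contra),
    forall a : poset_cat P, (prod_proj Q a \c kerm (end_cov - end_contra)) \c u = w a.
Proof.
move=> wW; have [_ kU] := kermP (end_cov - end_contra).
have /end_wedgeP tw : is_wedge (T := T) (fun a => prod_proj Q a \c prod_tuple Q w).
  by move=> a b f; rewrite !prod_tupleK; apply: wW.
have [u [ku uU]] := kU _ _ tw; exists u; split.
  by move=> a; rewrite -compmA ku prod_tupleK.
move=> v vw; apply: uU; apply: prod_tuple_uniq => a.
by rewrite compmA vw prod_tupleK.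
Qed.

Definition finposet_end : end_of T := End end_ker_wedge end_ker_univ.

End FinPosetEnd.

Definition pmodule (d : Order.disp_t) (P : finPOrderType d) (C : category) : Type :=
  functor (poset_cat P) C.

HB.instance Definition _ (d : Order.disp_t) (P : finPOrderType d) (C : category) :=
  Category.on (pmodule P C).

Definition enriched_hom (C : abelianClosedSymmetricMonoidalCategory)
    (d : Order.disp_t) (P : finPOrderType d) (M N : pmodule P C) : C :=
  end_ob (finposet_end
    (functor_comp (ihom_functor C) (functor_prod (functor_op M) N))).

Section PrincipalCofree.
Variables (C : additiveCategory) (d : Order.disp_t) (P : finPOrderType d).

Definition zero_unless (b : bool) (X : C) : C := if b then X else czero C.

(* In the case (true, true) both sides are X; in a principal cofree module the *)
(* case (false, true) does not occur, as b <= c <= a implies b <= a.           *)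
Definition zero_unless_map (b c : bool) (X : C) :
    zero_unless b X ~> zero_unless c X :=
  match b, c return zero_unless b X ~> zero_unless c X with
  | true, true => idm X
  | _, _ => 0
  end.

Definition principal_cofree (a : P) (X : C) : pmodule P C.
Proof.
apply: (@Functor (poset_cat P) C (fun b => zero_unless (b <= a :> P)%O X)
  (fun b c _ => zero_unless_map (b <= a :> P)%O (c <= a :> P)%O X)).
- by move=> b; case: (b <= a :> P)%O; rewrite //= idm_czero.
- move=> b c e ce bc.
  have ca : (e <= a :> P)%O -> (c <= a :> P)%O by apply: le_trans ce.
  have ba : (c <= a :> P)%O -> (b <= a :> P)%O by apply: le_trans bc.
  move: ca ba; case: (e <= a :> P)%O; last first.
    move=> _ _; rewrite /zero_unless_map.
    by case: (b <= a :> P)%O; case: (c <= a :> P)%O; rewrite ?comp0m.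
  by move=> -> // -> //=; rewrite comp1m.
Defined.

Definition pmodule_prod (I : finType) (F : I -> pmodule P C) : product F :=
  pointwise_product (fun b => finprod (fun i => F i b)).

End PrincipalCofree.

(* Main.v *)
Require Import Defs.
From mathcomp Require Import all_boot all_order ssralg.
From mathcomp Require Import boolp.

Set Implicit Arguments.
Unset Strict Implicit.
Unset Printing Implicit Defensive.

Import Order.TTheory GRing.Theory.

Local Open Scope ring_scope.
Local Open Scope cat_scope.

(** A cofree module [N] on a family [X] is determined by a universal property:
    there are maps [eps a : N a ~> X a], and a natural transformation from any
    module [K] into [N] is the same thing as an arbitrary family of maps
    [K a ~> X a], via composition with [eps].  In other words, cofree modules
    are the values of the right adjoint of the functor which forgets the
    action of the order relation.

    On the other hand, transposing along the tensor-hom adjunction turns a wedge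
    [W ~> ihom (M a) (N a)] into a natural transformation from the module
    [a |-> W \ot M a] to [N] ([wedge_ihomP]), so the enriched hom represents such
    transformations.  Putting both together, for every object [W],

      maps from [W] to the enriched hom of [M] and [N]
      = natural transformations [W \ot M a ~> N a]
      = families of maps [W \ot M a ~> X a]
      = families of maps [W ~> ihom (M a) (X a)]
      = maps from [W] to the product of the [ihom (M a) (X a)].

    The composite bijection is postcomposition with one fixed comparison map,
    which is therefore an isomorphism ([bijective_postcomp_iso]). *)

(** An instance of the Yoneda lemma.  The preimage [g] of the identity of [B] is
    a right inverse of [f]; it is a left inverse because [g \c f] and the
    identity are both preimages of [f]. *)
Lemma bijective_postcomp_iso (C : category) (A B : C) (f : A ~> B) :
  (forall (W : C) (v : W ~> B), exists! u : W ~> A, f \c u = v) -> is_iso f.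
Proof.
move=> f_bij; have [g [fg _]] := f_bij B (idm B).
exists g; split=> //; have [u [_ uU]] := f_bij A f.
by rewrite -(uU (idm A)) ?compm1 // -(uU (g \c f)) // compmA fg comp1m.
Qed.

Section ZeroUnless.
Variables (C : additiveCategory) (X : C).

Definition zero_unless_out (b : bool) : zero_unless b X ~> X :=
  if b return zero_unless b X ~> X then idm X else 0.

Definition zero_unless_lift (Y : C) (b : bool) :
    (b -> (Y ~> X)) -> (Y ~> zero_unless b X) :=
  if b return (b -> (Y ~> X)) -> (Y ~> zero_unless b X)
  then fun g => g isT else fun=> 0.

Lemma zero_unless_liftK (Y : C) (b : bool) (g : b -> (Y ~> X)) (h : b) :
  zero_unless_out b \c zero_unless_lift g = g h.
Proof. by case: b h g => // h g; rewrite comp1m (bool_irrelevance h isT). Qed.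

(** With [zero_unless_liftK], this says that a map into [zero_unless b X] is
    the same as a map into [X] that depends on a proof of [b]; it spares every
    later case distinction on whether [b] holds. *)
Lemma zero_unless_ext (Y : C) (b : bool) (u v : Y ~> zero_unless b X) :
  (b -> zero_unless_out b \c u = zero_unless_out b \c v) -> u = v.
Proof.
case: b u v => u v /= uv; first by have := uv isT; rewrite !comp1m.
by rewrite -[u]comp1m -[v]comp1m idm_czero !comp0m.
Qed.

Lemma zero_unless_out_map (b c : bool) : c ->
  zero_unless_out c \c zero_unless_map b c X = zero_unless_out b.
Proof. by case: c => // _; case: b; rewrite /= comp1m. Qed.

End ZeroUnless.

Section Cofree.
Variables (d : Order.disp_t) (P : finPOrderType d).

(** The couniversal property of the value at [X] of the right adjoint of the
    forgetful functor from modules to families of objects, with [eps] as the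
    counit.  Unlike the explicit product of principal cofree modules, it is
    visibly invariant under isomorphism of [N]. *)
Definition cofree_on (C : category) (X : P -> C) (N : pmodule P C)
    (eps : forall a : P, N a ~> X a) : Prop :=
  forall (K : pmodule P C) (g : forall a : P, K a ~> X a),
  exists! t : nattrans K N, forall a : P, eps a \c t a = g a.

(** The principal cofree module is the right Kan extension of [X] along the
    inclusion of the point [a].  For [b <= a], naturality along [b <= a] forces
    the component at [b] of a transformation extending [g] to be [g] composed
    with the structure map [K b ~> K a]; at the other points it lands in a zero
    object. *)
Lemma principal_cofree_univ (C : additiveCategory) (a : P) (X : C)
    (K : pmodule P C) (g : K a ~> X) :
  exists! t : nattrans K (principal_cofree a X),
    zero_unless_out X (a <= a)%O \c t a = g.
Proof.
pose t (b : poset_cat P) : K b ~> principal_cofree a X b :=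
  zero_unless_lift (fun h : (b <= a :> P)%O =>
    g \c @fmap _ _ K b a h).
have tE (b : P) (h : (b <= a)%O) :
    zero_unless_out X (b <= a)%O \c t b = g \c @fmap _ _ K b a h.
  exact: zero_unless_liftK.
have t_nat (b c : poset_cat P) (f : b ~> c) :
    t c \c fmap K f = fmap (principal_cofree a X) f \c t b.
  apply: zero_unless_ext => ca; rewrite !compmA zero_unless_out_map //.
  rewrite (tE c ca) (tE b (le_trans (f : (b <= c :> P)%O) ca)) -compmA -fmapM.
  by congr (g \c fmap K _); apply: bool_irrelevance.
exists (NatTrans t_nat); split=> /= [|s sg].
  rewrite (tE a (lexx a)).
  by rewrite [fmap _ _](fmap1 K (a : poset_cat P)) compm1.
apply: nattransP => b; apply: zero_unless_ext => h.
rewrite /= (tE b h) -sg -compmA.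
have -> := @nat_comm _ _ _ _ s b a h.
by rewrite compmA zero_unless_out_map.
Qed.

Definition cofree_counit (C : additiveCategory) (X : P -> C) (a : P) :
    (prod_ob (pmodule_prod (fun i : P => principal_cofree i (X i)))
       : pmodule P C) a ~> X a :=
  zero_unless_out (X a) (a <= a)%O
  \c prod_proj (finprod (fun i : P => principal_cofree i (X i) a)) a.

Lemma cofree_counit_univ (C : additiveCategory) (X : P -> C) :
  cofree_on (cofree_counit X).
Proof.
move=> K g; set F := fun i : P => principal_cofree i (X i).
have ex i : exists t : nattrans K (F i),
    zero_unless_out (X i) (i <= i)%O \c t i = g i.
  by have [t [tg _]] := principal_cofree_univ (g i); exists t.
pose t i := sval (cid (ex i)).
have tg i : zero_unless_out (X i) (i <= i)%O \c t i i = g i.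
  exact: (svalP (cid (ex i))).
exists (prod_tuple (pmodule_prod F) t); split=> [a|s sg].
  by rewrite /cofree_counit -compmA prod_tupleK tg.
apply: (prod_tuple_uniq (p := pmodule_prod F)) => i.
rewrite prod_tupleK; have [r [_ rU]] := principal_cofree_univ (g i).
rewrite -(rU (t i)) //; apply: rU.
by rewrite -sg /cofree_counit -compmA.
Qed.

Lemma cofree_on_iso (C : category) (X : P -> C) (N N' : pmodule P C)
    (f : nattrans N N') (eps : forall a : P, N' a ~> X a) :
  is_iso (f : N ~> N') -> cofree_on eps ->
  cofree_on (fun a => eps a \c f a).
Proof.
move=> [g [gf fg]] epsU K h; have [t [th tU]] := epsU K h.
exists ((g : N' ~> N) \c (t : K ~> N')); split=> [a|s sh].
  rewrite -compmA -th; congr (_ \c _).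
  (* Reassociate in the category of modules, where [f] and [g] are inverse. *)
  have -> : f a \c ((g : N' ~> N) \c (t : K ~> N') : nattrans _ _) a =
    (((f : N ~> N') \c g) \c (t : K ~> N') : nattrans _ _) a by rewrite -compmA.
  by rewrite fg comp1m.
rewrite (tU ((f : N ~> N') \c (s : K ~> N))) => [|a].
  by rewrite compmA gf comp1m.
by rewrite compmA.
Qed.

End Cofree.

Section EnrichedHom.
Variables (C : abelianClosedSymmetricMonoidalCategory).
Variables (d : Order.disp_t) (P : finPOrderType d).

Definition tens_left (W : C) : functor C C.
Proof.
apply: (@Functor C C (fun Y => W \ot Y) (fun Y Z f => idm W \otm f)).
- by move=> Y; apply: tensm1.
- by move=> Y Z V g f; apply: tensmMr.
Defined.

Definition tens_pmodule (W : C) (M : pmodule P C) : pmodule P C :=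
  functor_comp (tens_left W) M.

(** Both sides of the wedge condition are maps into [ihom (M a) (N b)], and they
    transpose to the two sides of the naturality square: the covariant action of
    [ihom] becomes postcomposition, and its contravariant action becomes
    precomposition in the second tensor factor. *)
Lemma wedge_ihomP (M N : pmodule P C) (W : C)
    (w : forall a : poset_cat P, W ~> ihom (M a) (N a)) :
  is_wedge (T := functor_comp (ihom_functor C) (functor_prod (functor_op M) N)) w
  <-> forall (a b : poset_cat P) (f : a ~> b),
    unadj (ihom_adj (M b)) (w b) \c fmap (tens_pmodule W M) f
    = fmap N f \c unadj (ihom_adj (M a)) (w a).
Proof.
have covE a b (f : a ~> b) :
    unadj (ihom_adj (M a)) (fmap (ihom_right (M a)) (fmap N f) \c w a)
    = fmap N f \c unadj (ihom_adj (M a)) (w a) by exact: unadj_natr.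
have contraE a b (f : a ~> b) :
    unadj (ihom_adj (M a)) (ihom_pre (N b) (fmap M f) \c w b)
    = unadj (ihom_adj (M b)) (w b) \c (idm W \otm fmap M f).
  rewrite !ihom_evE tensmMl compmA ihom_preE -!compmA; congr (_ \c _).
  by rewrite tensm_swap.
have wE (a b : poset_cat P) (f : a ~> b) :
    (@fmap _ _ (functor_comp (ihom_functor C) (functor_prod (functor_op M) N))
       (a, a) (a, b) (idm a, f) \c w a
     = @fmap _ _ (functor_comp (ihom_functor C) (functor_prod (functor_op M) N))
       (b, b) (a, b) (f, idm b) \c w b)
  <-> (fmap (ihom_right (M a)) (fmap N f) \c w a
       = ihom_pre (N b) (fmap M f) \c w b).
  rewrite /= (fmap1 N b) (fmap1 (ihom_right (M a))) comp1m.
  by rewrite (fmap1 M a) ihom_pre1 compm1.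
split=> [wW a b f|wN a b f].
  by rewrite -covE; move/wE: (wW a b f) => ->; rewrite contraE.
apply/wE; apply: (can_inj (@unadjK _ _ _ _ (ihom_adj (M a)) W (N b))).
by rewrite covE contraE -wN.
Qed.

Definition enriched_hom_proj (M N : pmodule P C) (a : P) :
    enriched_hom M N ~> ihom (M a) (N a) :=
  end_proj (finposet_end
    (functor_comp (ihom_functor C) (functor_prod (functor_op M) N))) a.

(** Together with [enriched_hom_transpose_nat], this is the adjunction between
    [W |-> tens_pmodule W M] and [N |-> enriched_hom M N]: the universal property
    of the end, read through [wedge_ihomP]. *)
Lemma enriched_hom_univ (M N : pmodule P C) (W : C)
    (t : nattrans (tens_pmodule W M) N) :
  exists! u : W ~> enriched_hom M N, forall a : P,
    unadj (ihom_adj (M a)) (enriched_hom_proj M N a \c u) = t a.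
Proof.
pose w (a : poset_cat P) : W ~> ihom (M a) (N a) := adj (ihom_adj (M a)) (t a).
have wW : is_wedge
    (T := functor_comp (ihom_functor C) (functor_prod (functor_op M) N)) w.
  by apply/wedge_ihomP => a b f; rewrite !adjK nat_comm.
have [u [uw uU]] := end_univ (finposet_end _) wW.
exists u; split=> [a|v vt]; first by rewrite /enriched_hom_proj uw adjK.
by apply: uU => a; rewrite /w -vt unadjK.
Qed.

Lemma enriched_hom_transpose_nat (M N : pmodule P C) (W : C)
    (u : W ~> enriched_hom M N) :
  exists t : nattrans (tens_pmodule W M) N, forall a : P,
    unadj (ihom_adj (M a)) (enriched_hom_proj M N a \c u) = t a.
Proof.
pose w (a : poset_cat P) : W ~> ihom (M a) (N a) :=
  enriched_hom_proj M N a \c u.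
have wN : is_wedge
    (T := functor_comp (ihom_functor C) (functor_prod (functor_op M) N)) w.
  move=> a b f; rewrite /w compmA [RHS]compmA; congr (_ \c _).
  exact: (@end_wedge _ _ _ (finposet_end _)).
by move/wedge_ihomP: wN => wN; exists (NatTrans wN).
Qed.

(** The comparison map has components [eps a] applied inside the internal hom.
    Its postcomposition action corresponds, after transposition, to composing
    natural transformations with [eps], which is bijective as [N] is cofree. *)
Lemma enriched_hom_cofree (M N : pmodule P C) (X : P -> C)
    (eps : forall a : P, N a ~> X a) :
  cofree_on eps ->
  enriched_hom M N \iso finprod (fun a : P => ihom (M a) (X a)).
Proof.
move=> epsU; set Q := finprod _.
pose f : enriched_hom M N ~> Q := prod_tuple Q (fun a =>
  fmap (ihom_right (M a)) (eps a) \c enriched_hom_proj M N a).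
have fE W (u : W ~> enriched_hom M N) a :
    unadj (ihom_adj (M a)) (prod_proj Q a \c (f \c u))
    = eps a \c unadj (ihom_adj (M a)) (enriched_hom_proj M N a \c u).
  by rewrite compmA prod_tupleK -compmA unadj_natr.
exists f; apply: bijective_postcomp_iso => W v.
have [t [tv tU]] := epsU (tens_pmodule W M)
  (fun a => unadj (ihom_adj (M a)) (prod_proj Q a \c v)).
have [u [ut uU]] := enriched_hom_univ t.
exists u; split=> [|u' u'v].
  apply: prod_tuple_uniq => a.
  apply: (can_inj (@unadjK _ _ _ _ (ihom_adj (M a)) W (X a))).
  by rewrite fE ut tv.
have [t' u't] := enriched_hom_transpose_nat u'.
apply: uU => a; rewrite u't (tU t') // => b.
by rewrite -u't -fE u'v.
Qed.

End EnrichedHom.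

Theorem proposition3p8 (C : abelianClosedSymmetricMonoidalCategory)
    (d : Order.disp_t) (P : finPOrderType d) (X : P -> C) (M N : pmodule P C) :
  N \iso pmodule_prod (fun a : P => principal_cofree a (X a)) ->
  enriched_hom M N \iso finprod (fun a : P => ihom (M a) (X a)).
Proof.
move=> [f f_iso].
exact: enriched_hom_cofree (cofree_on_iso f_iso (@cofree_counit_univ _ _ _ X)).
Qed.
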